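(* Let $n\in\mathbb{N}$ and $\varepsilon>0$ be given. If $n\geqslant 2$ and $\varepsilon<\frac{1}{32}$, then every connected compact unitary group $\mathcal{G}\subseteq M_n(\mathbb{C})$ with a weak $\varepsilon$-approximate fixed point is reducible.
   Context: A unitary group $\mathcal{G}\subseteq M_n(\mathbb{C})$ is a group of unitary $n\times n$ complex matrices. $\mathbb{C}^n$ carries the standard inner product and $\|\cdot\|$ is the Euclidean norm. For $0<\varepsilon<1$, a vector $\xi\in\mathbb{C}^n$ with $\|\xi\|=1$ is a weak $\varepsilon$-approximate fixed point of $\mathcal{G}$ if $|\langle G\xi,\xi\rangle|\geqslant 1-\varepsilon$ for all $G\in\mathcal{G}$. $\mathcal{G}$ is reducible if there is a subspace of $\mathbb{C}^n$, different from $\{0\}$ and $\mathbb{C}^n$, that is invariant under every $G\in\mathcal{G}$. *)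

(* Defs.v *)
From HB Require Import structures.
From mathcomp Require Import all_boot all_order all_algebra.
From mathcomp Require Import complex.
From mathcomp Require Import all_classical all_reals topology normedtype.
Import Order.TTheory GRing.Theory Num.Theory.
Import numFieldNormedType.Exports.

Set Implicit Arguments.
Unset Strict Implicit.
Unset Printing Implicit Defensive.

Local Open Scope classical_set_scope.
Local Open Scope ring_scope.
Local Open Scope complex_scope.

(* [R[i]] gets the topology of its modulus; ['M[R[i]]_n] then inherits the
   entrywise topology, i.e. the usual one of a finite-dimensional space. *)
HB.instance Definition _ (R : realType) :=
  PseudoPointedMetric.copy R[i] (R[i] : numFieldType)^o.

(* Linear in the first argument; [dotmx] is the library's inner product on row
   vectors. *)
Definition cdot (R : realType) (n : nat) (x y : 'cV[R[i]]_n) : R[i] :=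
  dotmx x^T y^T.

(* Euclidean norm; the library norm [`|x|] of a matrix is the sup norm. *)
Definition cnorm2 (R : realType) (n : nat) (x : 'cV[R[i]]_n) : R[i] :=
  sqrtC (cdot x x).

Record unitary_group (R : realType) (n : nat) (G : set 'M[R[i]]_n) : Prop :=
  UnitaryGroup {
    unitary_group_unitary : forall A, G A -> A \is unitarymx;
    unitary_group1 : G 1%:M;
    unitary_groupM : forall A B, G A -> G B -> G (A *m B);
    unitary_groupV : forall A, G A -> G (invmx A) }.

(* Both sides of the inequality are real, so it is the order of [R]. *)
Definition weak_approx_fixed_point (R : realType) (n : nat)
    (eps : R) (G : set 'M[R[i]]_n) (xi : 'cV[R[i]]_n) : Prop :=
  cnorm2 xi = 1 /\ forall A, G A -> (1 - eps)%:C <= `|cdot (A *m xi) xi|.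

Definition reducible (R : realType) (n : nat) (G : set 'M[R[i]]_n) : Prop :=
  exists U : {vspace 'cV[R[i]]_n},
    [/\ U <> 0%VS, U <> fullv &
        forall A, G A -> forall v, v \in U -> A *m v \in U].

(* Main.v *)
Require Import Defs.
From HB Require Import structures.
From mathcomp Require Import all_boot all_order all_algebra.
From mathcomp Require Import complex.
From mathcomp Require Import all_classical all_reals topology normedtype.
From mathcomp Require Import derive.
From mathcomp Require Import ring lra.
Import Order.TTheory GRing.Theory Num.Theory.
Import numFieldNormedType.Exports.

(** Let P = xi xi^* be the orthogonal projection onto the line of the
    approximate fixed point xi, and c = (1 - eps)^2.  Passing from xi to P
    removes the phases: for the real inner product Re tr (X Y^* ) on matrices,
    the conjugates A P A^*, A in G, satisfy <A P A^*, P> = |<A xi, xi>|^2 >= c.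

    A matrix T that commutes with G and satisfies <T, P> >= c is obtained by
    convexity instead of integration over G.  The set K of matrices X with
    <X, A P A^* > >= c for all A in G is closed and convex, is invariant under
    conjugation by G, and contains P.  Its point T of least norm is
    unique, and conjugation by G is isometric, so T is fixed by conjugation
    ([unitary_group_commutant], resting on [isometry_invariant_point]).
    Moreover |T| <= |P| = 1, as P lies in K.

    By Schur's argument an eigenspace of T is a proper invariant subspace unless
    T is a scalar lam ([commuting_nonscalar_reducible]).  In that case
    Re lam = <T, P> >= c while n |lam|^2 = |T|^2 <= 1, so n c^2 <= 1.  For n >= 2
    and eps < 1/32 this is impossible, since c > 3/4. *)

Local Open Scope classical_set_scope.
Local Open Scope ring_scope.
Local Open Scope complex_scope.
Local Open Scope sesquilinear_scope.

(** * Least norm points in a real Euclidean space *)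

Definition rdot {R : realType} {m : nat} (u v : 'rV[R]_m) : R :=
  \sum_j u 0 j * v 0 j.

Lemma rdotC {R : realType} {m} (u v : 'rV[R]_m) : rdot u v = rdot v u.
Proof. by apply: eq_bigr => j _; rewrite mulrC. Qed.

Lemma rdotDl {R : realType} {m} (u v w : 'rV[R]_m) :
  rdot (u + v) w = rdot u w + rdot v w.
Proof. by rewrite -big_split; apply: eq_bigr => j _; rewrite mxE mulrDl. Qed.

Lemma rdotZl {R : realType} {m} a (u v : 'rV[R]_m) :
  rdot (a *: u) v = a * rdot u v.
Proof. by rewrite mulr_sumr; apply: eq_bigr => j _; rewrite mxE mulrA. Qed.

Lemma sqr_coord_le_rdot {R : realType} {m} (v : 'rV[R]_m) j :
  v 0 j ^+ 2 <= rdot v v.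
Proof.
rewrite /rdot (bigD1 j) //= -expr2 lerDl.
by apply: sumr_ge0 => k _; rewrite -expr2 sqr_ge0.
Qed.

Lemma rdot_ge0 {R : realType} {m} (v : 'rV[R]_m) : 0 <= rdot v v.
Proof. by apply: sumr_ge0 => k _; rewrite -expr2 sqr_ge0. Qed.

Lemma rdot_le0_eq0 {R : realType} {m} (v : 'rV[R]_m) : rdot v v <= 0 -> v = 0.
Proof.
move=> v_le0; apply/rowP => j; rewrite mxE; apply/eqP.
by rewrite -sqrf_eq0 eq_le sqr_ge0 (le_trans (sqr_coord_le_rdot v j)).
Qed.

Lemma continuous_rdot {R : realType} {m} (f g : 'rV[R]_m -> 'rV[R]_m) :
  continuous f -> continuous g -> continuous (fun v => rdot (f v) (g v)).
Proof.
move=> f_cont g_cont.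
rewrite /rdot; apply: (continuous_big add_continuous) => j _ v.
have coord_cvg (h : 'rV[R]_m -> 'rV[R]_m) :
    continuous h -> {for v, continuous (fun u => h u 0 j)}.
  move=> h_cont; apply: (@continuous_comp _ _ _ h (fun w => w 0 j)).
    exact: h_cont.
  exact: coord_continuous.
exact: (cvgM (coord_cvg _ f_cont) (coord_cvg _ g_cont)).
Qed.

(** Only the points of K no longer than a chosen one can compete; they form a
    compact set, on which the norm attains its minimum. *)
Lemma least_norm_exists {R : realType} {m} (S : set 'rV[R]_m) (c : R) :
  let K := [set v | forall s, S s -> c <= rdot v s] in
  K !=set0 -> exists2 v, K v & forall w, K w -> rdot v v <= rdot w w.
Proof.
move=> K [v0 Kv0].
pose B := K `&` [set v | rdot v v <= rdot v0 v0].
have B_closed : closed B.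
  apply: closedI.
    have -> : K = \bigcap_(s in S) ((fun v => rdot v s) @^-1` [set x | c <= x]).
      by apply/seteqP; split => v /= Kv s; exact: Kv.
    apply: closed_bigI => s _; apply: closed_comp; last exact: closed_ge.
    move=> v _; apply: (continuous_rdot id (fun=> s)).
      by move=> u; exact: cvg_id.
    by move=> u; apply: (@cvg_cst _ s _ (nbhs u)); exact: nbhs_filter.
  rewrite -[X in closed X]/((fun v => rdot v v) @^-1` [set x | x <= rdot v0 v0]).
  apply: closed_comp; last exact: closed_le.
  by move=> v _; apply: (continuous_rdot id id) => u; exact: cvg_id.
(* Each coordinate x satisfies x ^+ 2 <= rdot v0 v0, hence `|x| <= M; the extra 1
   covers the case rdot v0 v0 < 1. *)
pose M := rdot v0 v0 + 1.
have B_compact : compact B.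
  apply: subclosed_compact B_closed
      (@rV_compact R m (fun=> `[- M, M]%classic) _) _.
    by move=> _; exact: segment_compact.
  move=> v [_ /= v_le] j; rewrite /= in_itv /= -ler_norml.
  have := le_trans (sqr_coord_le_rdot v j) v_le.
  rewrite -real_normK ?num_real // /M.
  have := normr_ge0 (v 0 j); have := rdot_ge0 v0; nra.
have B_neq0 : B !=set0 by exists v0; split=> //=.
have [v] := EVT_min_rV B_neq0 B_compact
  (continuous_subspaceT
    (continuous_rdot id id (fun=> cvg_id) (fun=> cvg_id))).
rewrite inE => -[Kv _] v_min; exists v => // w Kw.
have [w_le|/ltW w_ge] := leP (rdot w w) (rdot v0 v0).
  by apply: v_min; rewrite inE.
by apply: le_trans w_ge; apply: v_min; rewrite inE; split=> //=.
Qed.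

(** This replaces averaging over a group of isometries.  The least norm point v
    of the intersection K of the half-spaces c <= <., s> is unique, by the
    parallelogram law at the midpoint of two candidates; an isometry f whose
    image of S covers S maps K into K, as <f v, f s> = <v, s>, and so fixes v.  The hypothesis on S says that S itself lies
    in K, which makes K nonempty and bounds the norm of v. *)
Lemma isometry_invariant_point {R : realType} {m} (S : set 'rV[R]_m) (c : R) :
    S !=set0 -> (forall s t, S s -> S t -> c <= rdot s t) ->
  exists v, [/\ forall s, S s -> c <= rdot v s,
    forall s, S s -> rdot v v <= rdot s s &
    forall f : 'rV[R]_m -> 'rV[R]_m, (forall u w, rdot (f u) (f w) = rdot u w) ->
      S `<=` f @` S -> f v = v].
Proof.
move=> [s0 Ss0] S_ge; have [|v Kv v_min] := least_norm_exists S c.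
  by exists s0 => s; exact: S_ge.
exists v; split=> // [s Ss|f f_iso Sf]; first by apply: v_min => t; exact: S_ge.
have Kfv s : S s -> c <= rdot (f v) s.
  by move=> /Sf [t St <-]; rewrite f_iso; exact: Kv.
have Kmid s : S s -> c <= rdot (2^-1 *: (f v + v)) s.
  move=> Ss; rewrite rdotZl rdotDl; have := Kfv s Ss; have := Kv s Ss; lra.
have := v_min _ Kmid.
rewrite rdotZl rdotDl ![rdot _ (2^-1 *: _)]rdotC !rdotZl.
rewrite !(rdotDl, rdotC _ (_ + _)) f_iso => mid_ge.
apply/eqP; rewrite -subr_eq0; apply/eqP/rdot_le0_eq0.
rewrite -[- v]scaleN1r rdotDl rdotZl ![rdot _ (_ + _)]rdotC !rdotDl !rdotZl f_iso.
move: mid_ge; rewrite [rdot v (f v)]rdotC; lra.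
Qed.

(** * Complex matrices as a real Euclidean space *)

(** The real part of the Hilbert-Schmidt inner product. *)
Definition hsdot {R : realType} {n : nat} (X Y : 'M[R[i]]_n) : R :=
  complex.Re (\tr (X *m Y^t*)).

(** Real and imaginary parts side by side: this identifies the complex matrices
    under [hsdot] with a real Euclidean space, where least norm points exist. *)
Definition realify {R : realType} {n : nat} (X : 'M[R[i]]_n) :
    'rV[R]_(n * n + n * n) :=
  row_mx (mxvec (map_mx (@complex.Re R) X)) (mxvec (map_mx (@complex.Im R) X)).

Definition complexify {R : realType} {n : nat} (v : 'rV[R]_(n * n + n * n)) :
    'M[R[i]]_n :=
  \matrix_(i, j) (vec_mx (lsubmx v) i j +i* vec_mx (rsubmx v) i j).

Lemma realifyK {R : realType} {n} : cancel (@realify R n) complexify.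
Proof.
move=> X; apply/matrixP => i j.
by rewrite mxE row_mxKl row_mxKr !mxvecK !mxE; case: (X i j).
Qed.

Lemma complexifyK {R : realType} {n} : cancel (@complexify R n) realify.
Proof.
move=> v; rewrite /realify -[RHS]hsubmxK; congr row_mx.
  by rewrite -[RHS]vec_mxK; congr mxvec; apply/matrixP => i j; rewrite !mxE.
by rewrite -[RHS]vec_mxK; congr mxvec; apply/matrixP => i j; rewrite !mxE.
Qed.

Lemma rdot_row_mx {R : realType} {m1 m2} (u v : 'rV[R]_m1) (u' v' : 'rV[R]_m2) :
  rdot (row_mx u u') (row_mx v v') = rdot u v + rdot u' v'.
Proof.
rewrite /rdot big_split_ord /=; congr (_ + _); apply: eq_bigr => j _.
  by rewrite !row_mxEl.
by rewrite !row_mxEr.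
Qed.

Lemma rdot_mxvec {R : realType} {m n} (A B : 'M[R]_(m, n)) :
  rdot (mxvec A) (mxvec B) = \sum_i \sum_j A i j * B i j.
Proof.
rewrite /rdot (reindex _ (curry_mxvec_bij _ _)) pair_bigA /=.
by apply: eq_bigr => -[i j] _ /=; rewrite !mxvecE.
Qed.

Lemma Re_mul_conj {R : realType} (x y : R[i]) :
  complex.Re (x * Num.conj y) =
  complex.Re x * complex.Re y + complex.Im x * complex.Im y.
Proof. by case: x y => [a b] [c d] /=; rewrite mulrN opprK. Qed.

Lemma rdot_realify {R : realType} {n} (X Y : 'M[R[i]]_n) :
  rdot (realify X) (realify Y) = hsdot X Y.
Proof.
rewrite rdot_row_mx !rdot_mxvec -big_split /hsdot /mxtrace raddf_sum.
apply: eq_bigr => i _; rewrite -big_split mxE raddf_sum.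
by apply: eq_bigr => j _; rewrite !mxE; apply/esym/Re_mul_conj.
Qed.

(** * Conjugation by a unitary group *)

Lemma trmxC_mul {R : realType} {m n p} (A : 'M[R[i]]_(m, n)) (B : 'M[R[i]]_(n, p)) :
  (A *m B)^t* = B^t* *m A^t*.
Proof. by rewrite trmx_mul map_mxM. Qed.

Lemma unitarymxV {R : realType} {n} {A : 'M[R[i]]_n} :
  A \is unitarymx -> A^t* *m A = 1%:M.
Proof. by move=> /unitarymxP /mulmx1C. Qed.

Lemma hsdot_conj {R : realType} {n} (A X Y : 'M[R[i]]_n) :
  A \is unitarymx -> hsdot (A *m X *m A^t*) (A *m Y *m A^t*) = hsdot X Y.
Proof.
move=> A_unitary; rewrite /hsdot !trmxC_mul trmxCK !mulmxA.
rewrite -[A *m X *m A^t* *m A]mulmxA unitarymxV // mulmx1.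
by rewrite -!mulmxA mxtrace_mulC -!mulmxA unitarymxV // mulmx1.
Qed.

(** A lower bound for <., P> on the orbit of P under conjugation is inherited by
    some matrix that commutes with the group and is no longer than P: take the
    invariant point of the orbit.  Any two orbit points have inner product at
    least c because <A P A^*, B P B^* > = <C P C^*, P> with C = B^-1 A. *)
Lemma unitary_group_commutant {R : realType} {n : nat} (G : set 'M[R[i]]_n)
    (P : 'M[R[i]]_n) (c : R) :
    unitary_group G -> (forall A, G A -> c <= hsdot (A *m P *m A^t*) P) ->
  exists T, [/\ c <= hsdot T P, hsdot T T <= hsdot P P &
    forall A, G A -> A *m T = T *m A].
Proof.
move=> [G_unitary G1 GM GV] P_ge.
pose conj (A X : 'M[R[i]]_n) := A *m X *m A^t*.
have conj_inv A B X : G A -> conj A (conj (invmx A *m B) X) = conj B X.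
  move=> GA; have A_unitary := G_unitary _ GA; rewrite /conj trmxC_mul.
  rewrite invmx_unitary // trmxCK !mulmxA.
  have AK Y : Y *m A *m A^t* = Y by rewrite -mulmxA (unitarymxP A_unitary) mulmx1.
  by rewrite AK (unitarymxP A_unitary) mul1mx.
have conj1 X : conj 1%:M X = X.
  by rewrite /conj trmx1 map_mx1 mulmx1 mul1mx.
pose S := [set realify (conj A P) | A in G].
have SP : S (realify P) by exists 1%:M => //; rewrite conj1.
have S_ge s t : S s -> S t -> c <= rdot s t.
  move=> [A GA <-] [B GB <-]; rewrite rdot_realify -(conj_inv _ A _ GB).
  by rewrite hsdot_conj ?G_unitary //; apply: P_ge; exact: GM (GV _ GB) GA.
have [v [v_ge v_le v_fix]] :=
  isometry_invariant_point S c (ex_intro _ _ SP) S_ge.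
exists (complexify v); split.
- by have := v_ge _ SP; rewrite -[v in rdot v _]complexifyK rdot_realify.
- have := v_le _ SP.
  by rewrite -[v in rdot v v]complexifyK !rdot_realify.
move=> A GA; have A_unitary := G_unitary _ GA.
have conj_v : realify (conj A (complexify v)) = v.
  apply: (v_fix (fun u => realify (conj A (complexify u)))) => [u w|_ [B GB <-]].
    by rewrite rdot_realify hsdot_conj // -rdot_realify !complexifyK.
  exists (realify (conj (invmx A *m B) P)); last by rewrite realifyK conj_inv.
  by exists (invmx A *m B) => //; apply: GM => //; exact: GV.
have /(congr1 (fun X => X *m A)) := congr1 complexify conj_v.
by rewrite realifyK /conj -!mulmxA unitarymxV // mulmx1.
Qed.

(** Schur's lemma: the invariant subspace is an eigenspace of T. *)
Lemma commuting_nonscalar_reducible {R : realType} {n : nat}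
    (G : set 'M[R[i]]_n) (T : 'M[R[i]]_n) :
    (0 < n)%N -> (forall A, G A -> A *m T = T *m A) ->
    (forall lam, T <> lam%:M) ->
  reducible G.
Proof.
move=> n_gt0 T_comm T_nonscalar.
(* [eigenvalue] speaks of row eigenvectors, hence the transpose. *)
have [lam] := eigenvalue_closed T^T n_gt0.
move=> /eigenvalueP [u u_eigen u_neq0].
pose N := T - lam%:M.
pose U : {vspace 'cV[R[i]]_n} := lker (linfun (mulmx N)).
have memU v : (v \in U) = (N *m v == 0) by rewrite memv_ker lfunE.
exists U; split.
- move=> U0; have : u^T \in U.
    rewrite memU mulmxBl mul_scalar_mx subr_eq0 -[T]trmxK -trmx_mul u_eigen.
    by rewrite linearZ.
  by rewrite U0 memv0 trmx_eq0 (negPf u_neq0).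
- move=> UT; apply: (T_nonscalar lam); apply/eqP; rewrite -subr_eq0; apply/eqP.
  have N0 (v : 'cV_n) : N *m v = 0 by apply/eqP; rewrite -memU UT memvf.
  by apply/matrixP => i j; have /colP/(_ i) := N0 (delta_mx j 0);
     rewrite -colE !mxE.
move=> A GA v; rewrite !memU => /eqP Nv0.
have -> : N *m (A *m v) = A *m (N *m v).
  rewrite !mulmxA; congr (_ *m v).
  by rewrite mulmxBl mulmxBr T_comm // scalar_mxC.
by rewrite Nv0 mulmx0.
Qed.

(** * The projection onto an approximate fixed point *)

Lemma cdotE {R : realType} {n} (x y : 'cV[R[i]]_n) : cdot x y = (y^t* *m x) 0 0.
Proof.
rewrite /cdot dotmxE !mxE; apply: eq_bigr => j _; rewrite !mxE.
by rewrite mulrC.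
Qed.

Lemma mxtrace_rank1 {R : realType} {n} (A : 'M[R[i]]_n) (x : 'cV[R[i]]_n) :
  \tr (A *m (x *m x^t*)) = cdot (A *m x) x.
Proof. by rewrite mulmxA mxtrace_mulC trace_mx11 cdotE. Qed.

(** Conjugating the rank one matrix x x^* by A forgets the phase of A x, which
    turns the modulus of <A x, x> into a genuine inner product. *)
Lemma hsdot_rank1 {R : realType} {n} (A : 'M[R[i]]_n) (x : 'cV[R[i]]_n) :
  (hsdot (A *m (x *m x^t*) *m A^t*) (x *m x^t*))%:C = `|cdot (A *m x) x| ^+ 2.
Proof.
have -> : A *m (x *m x^t*) *m A^t* = (A *m x) *m (A *m x)^t*.
  by rewrite trmxC_mul !mulmxA.
move: (A *m x) => y; rewrite /hsdot trmxC_mul trmxCK.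
rewrite [X in \tr X]mulmxA mxtrace_mulC trace_mx11 -(mulmxA y) (mulmxA (x^t*)).
have -> : (x^t* *m y *m (y^t* *m x)) 0 0 = cdot y x * (cdot y x)^*.
  rewrite mxE big_ord1 cdotE; congr (_ * _).
  rewrite !mxE raddf_sum; apply: eq_bigr => j _ /=.
  by rewrite !mxE rmorphM /= conjCK mulrC.
by rewrite -normCK RRe_real // rpredX // normr_real.
Qed.

Theorem proposition7p2 (R : realType) (n : nat) (eps : R)
    (eps_gt0 : 0 < eps) (n_ge2 : (2 <= n)%N) (eps_lt : eps < 1 / 32%:R)
    (G : set 'M[R[i]]_n) (G_group : unitary_group G)
    (G_connected : connected G) (G_compact : compact G)
    (G_fixed : exists xi : 'cV[R[i]]_n, weak_approx_fixed_point eps G xi) :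
  reducible G.
Proof.
have [xi [xi_norm xi_fixed]] := G_fixed.
have cdot_xi : cdot xi xi = 1.
  by rewrite -[LHS]sqrtCK -/(cnorm2 xi) xi_norm expr1n.
pose P := xi *m xi^t*; pose c := (1 - eps) ^+ 2.
have P_ge A : G A -> c <= hsdot (A *m P *m A^t*) P.
  move=> /xi_fixed A_ge; rewrite -lecR hsdot_rank1 rmorphXn.
  by rewrite lerXn2r // nnegrE ?normr_ge0 // lecR; lra.
have hsdotPP : hsdot P P = 1.
  apply/complexI; have := hsdot_rank1 1%:M xi.
  by rewrite trmx1 map_mx1 mulmx1 !mul1mx cdot_xi normr1 expr1n.
have [T [T_ge T_le T_comm]] := unitary_group_commutant G P c G_group P_ge.
apply: (commuting_nonscalar_reducible G T _ T_comm); first exact: ltnW.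
move=> lam T_scalar.
have P_herm : P^t* = P by rewrite trmxC_mul trmxCK.
have Re_lam : c <= complex.Re lam.
  move: T_ge; rewrite /hsdot P_herm mxtrace_rank1 T_scalar mul_scalar_mx.
  by rewrite cdotE -scalemxAr mxE -cdotE cdot_xi mulr1.
have lam_le : complex.Re lam ^+ 2 *+ n <= 1.
  rewrite -hsdotPP; apply: le_trans T_le.
  rewrite /hsdot T_scalar tr_scalar_mx map_scalar_mx -scalar_mxM mxtrace_scalar.
  rewrite raddfMn lerMn2r /= Re_mul_conj -!expr2 lerDl.
  by rewrite sqr_ge0 orbT.
have lam2_le : complex.Re lam ^+ 2 * 2%:R <= 1.
  apply: le_trans lam_le; rewrite -[leRHS]mulr_natr ler_wpM2l ?sqr_ge0 //.
  by rewrite ler_nat.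
(* 3/4 suffices: 2 * (3/4)^2 = 9/8 > 1. *)
have c_ge : 3%:R / 4%:R <= c by rewrite /c; nra.
have lam_ge := le_trans c_ge Re_lam; nra.
Qed.
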